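(* Suppose $p\ge 5$ is a prime and $r$ is a positive integer. For $x\in\{\frac12,\frac13,\frac14,\frac16\}$, we have $$\sum_{k=0}^{p^r-1}\frac{(x)_k(1-x)_k}{(1)_k^2}\equiv (-1)^{\langle -x\rangle_p\cdot r}\pmod{p^2}.$$
   Context: For a number $a$, $(a)_0=1$ and $(a)_k=a(a+1)\cdots(a+k-1)$ for $k\ge1$ (so $(1)_k=k!$). The sum on the left is the truncated hypergeometric series ${}_2F_1\left[\begin{smallmatrix}x,\,1-x\\1\end{smallmatrix};1\right]_{p^r}$. For a $p$-adic integer $a$, $\langle a\rangle_p$ denotes the least non-negative integer $s$ with $a\equiv s\pmod p$. Congruences modulo $p^2$ between rational numbers are understood in the ring of $p$-adic integers (equivalently, the difference lies in $p^2\mathbb{Z}_{(p)}$). *)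

(* Defs.v *)
From mathcomp Require Import all_boot all_order all_algebra.

Set Implicit Arguments.
Unset Strict Implicit.
Unset Printing Implicit Defensive.

Import Order.TTheory GRing.Theory Num.Theory.
Local Open Scope ring_scope.

(* Rising factorial (a)_k = a (a + 1) ... (a + k - 1). *)
Definition pochhammer (R : nzRingType) (a : R) (k : nat) : R :=
  \prod_(i < k) (a + i%:R).

(* The localization Z_(p), as a predicate on rat. *)
Definition Zloc (p : nat) : pred rat := fun q => ~~ (p %| `|denq q|)%N.

(* a = b (mod p ^ m), in the sense that a - b lies in p ^ m Z_(p). *)
Definition eqmodp (p m : nat) (a b : rat) : bool :=
  Zloc p ((a - b) / p%:R ^+ m).

(* The least non-negative integer s with a = s (mod p). For p prime and a in
   Z_(p) such an s exists below p (least_residueP), so the search can stop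
   there; the value is the junk p when a is not in Z_(p). *)
Definition least_residue (p : nat) (a : rat) : nat :=
  find (fun s : nat => eqmodp p 1 a s%:R) (iota 0 p).

Lemma Zloc_frac (p : nat) (m d : int) :
  ~~ (p %| `|d|)%N -> Zloc p (m%:~R / d%:~R).
Proof.
rewrite /Zloc; case: divqP => [_|k x _]; first by rewrite dvdn0.
by apply: contra => pd; rewrite abszM dvdn_mull.
Qed.

Lemma eqmodp_least_residue_ex (p : nat) (a : rat) :
  prime p -> Zloc p a -> exists2 s : nat, (s < p)%N & eqmodp p 1 a s%:R.
Proof.
move=> pp pa; have p0 := prime_gt0 pp.
have cop : coprimez (denq a) p%:Z.
  by rewrite coprimezE /= coprime_sym prime_coprime.
have /coprimezP [[u v] /= uv] := cop.
pose s := ((u * numq a) %% p%:Z)%Z.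
have s0 : 0 <= s by rewrite modz_ge0 // eqz_nat -lt0n.
have sp : s < p%:Z by rewrite ltz_pmod.
have [t st] : exists t : nat, s = t%:Z by exists `|s|%N; rewrite gez0_abs.
exists t; first by move: sp; rewrite st ltz_nat.
pose k := v * numq a + ((u * numq a) %/ p%:Z)%Z * denq a.
have dk : numq a - t%:Z * denq a = k * p%:Z.
  set q := ((u * numq a) %/ p%:Z)%Z in k *.
  have -> : t%:Z = u * numq a - q * p%:Z.
    by rewrite -st {1}(divz_eq (u * numq a) p%:Z) addrC addKr.
  rewrite mulrBl opprB addrCA addrC [in RHS]mulrDl.
  congr (_ + _); last by rewrite mulrAC.
  apply/eqP; rewrite subr_eq ![_ * numq a * _]mulrAC -mulrDl addrC uv.
  by rewrite mul1r.
rewrite /eqmodp expr1.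
suff -> : (a - t%:R) / p%:R = k%:~R / (denq a)%:~R by apply: Zloc_frac.
have pq : p%:R != 0 :> rat by rewrite pnatr_eq0 -lt0n.
have dq : (denq a)%:~R != 0 :> rat by rewrite intr_eq0 denq_neq0.
apply/eqP; rewrite eqr_div // mulrBl -numqE.
rewrite -[t%:R]/(t%:Z%:~R) -[p%:R]/(p%:Z%:~R) -!intrM -intrB dk.
by [].
Qed.

Lemma least_residueP (p : nat) (a : rat) : prime p -> Zloc p a ->
  [/\ (least_residue p a < p)%N,
      eqmodp p 1 a (least_residue p a)%:R &
      forall t : nat, eqmodp p 1 a t%:R -> (least_residue p a <= t)%N].
Proof.
move=> pp pa; have [s sp es] := eqmodp_least_residue_ex pp pa.
have h : has (fun s : nat => eqmodp p 1 a s%:R) (iota 0 p).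
  by apply/hasP; exists s; rewrite // mem_iota.
have lp : (least_residue p a < p)%N.
  by move: h; rewrite has_find size_iota.
split=> // [|t et]; first by have := nth_find 0%N h; rewrite nth_iota.
rewrite leqNgt; apply/negP => lt.
have := before_find 0%N lt; rewrite nth_iota ?(ltn_trans lt) //.
by rewrite add0n et.
Qed.

(* Main.v *)
Require Import Defs.
From mathcomp Require Import all_boot all_order all_algebra.
From mathcomp Require Import ring zify.

Set Implicit Arguments.
Unset Strict Implicit.
Unset Printing Implicit Defensive.

Import Order.TTheory GRing.Theory Num.Theory.
Local Open Scope ring_scope.

(** Write q = p ^ r, and F(a) for the sum over k < q of C(a, k) C(-1 - a, k),
which is the truncated series at x = - a.  The whole argument rests on

   F(a) = (-1) ^ A  (mod p ^ 2),   A = the residue of a modulo q,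

for every a in Z_(p) ([hypergeometric_sum_residue]).  As F is a polynomial in
a with coefficients in Q, replacing a by a natural number t that is close to a
p-adically does not change F(a) modulo p ^ 2 ([eqmodp_hypergeometric_sum]), so
only a = t in nat matters.

For natural t, F telescopes ([trunc_legendreS]):
   F(t + 1) + F(t) = 2 (-1) ^ (q - 1) C(t, q - 1) C(t + q, q - 1).
If q does not divide t + 1, each binomial on the right is a multiple of p, so
F changes sign from t to t + 1 modulo p ^ 2.  It remains to see that
F(u q) = 1.  For 0 < k < q, p divides C(u q, k) and C(u q + k, k) = 1 modulo
p, so for u > 0 the sum F(u q) collapses to the alternating sum of the
C(u q, k), which is D(u) = C(u q - 1, q - 1) ([trunc_legendre_mul]).  The
telescoping relation at t + 1 = (u + 1) q has 2 D(u + 1) D(u + 2) on the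
right, hence reads
   F((u + 1) q) + F(u q) = 2 F((u + 1) q) F((u + 2) q),
and F = 1 propagates from u = 0, 1 because 2 is invertible
([trunc_legendre_mul_eq1]).

For x = 1 / d with d in {2, 3, 4, 6}, every unit modulo d is 1 or -1.  The
residue of - 1 / d modulo p ^ r is therefore (p ^ r - 1) / d or
((d - 1) p ^ r - 1) / d, and an induction on r shows that it has the parity of
s r, where s is the residue modulo p ([neg_inv_residue_parity1],
[neg_inv_residue_parityN1]). *)

(** * Truncated Legendre sums and their telescoping relation *)

(** The first n terms, at y = 1, of the expansion in powers of y of P(1 - 2 y),
where P is the Legendre polynomial of degree t; here (-1) ^ k C(t + k, k) is
C(-1 - t, k).  The ring is arbitrary so that congruences modulo p ^ 2 become
equalities in 'Z_(p ^ 2). *)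
Definition trunc_legendre (R : comNzRingType) (n t : nat) : R :=
  \sum_(k < n) (-1) ^+ k * ('C(t, k) * 'C(t + k, k))%:R.

(** The k-th terms at t + 1 and t add up to
2 (t + 1) (-1) ^ k (t + k) ... (t - k + 2) / k! ^ 2, which is a difference in
k of the products on the right. *)
Lemma trunc_legendreS (R : comNzRingType) (n t : nat) :
  trunc_legendre R n.+1 t.+1 + trunc_legendre R n.+1 t =
  2%:R * (-1) ^+ n * ('C(t, n) * 'C(t.+1 + n, n))%:R.
Proof.
rewrite /trunc_legendre; elim: n => [|n IHn].
  by rewrite !big_ord_recr !big_ord0 /= !bin0; ring.
rewrite big_ord_recr [X in _ + X]big_ord_recr /= addrACA IHn.
have key : ('C(t, n) * 'C(t + n.+1, n.+1) =
            'C(t.+1, n.+1) * 'C(t + n.+1, n))%N.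
  apply/eqP; rewrite -(eqn_pmul2l (ltn0Sn n)).
  rewrite mulnCA mul_bin_left -addSnnS addnK [X in _ == X]mulnA -mul_bin_diag.
  by rewrite -[t.+1.-1]/t; apply/eqP; ring.
move: key; rewrite !(addSn, addnS) !binS => key.
have /(congr1 (fun m : nat => m%:R : R)) := key.
rewrite !natrM !natrD !exprS.
(* The identity reduces to e times the natural number identity above. *)
move: ((-1) ^+ n) ('C(t, n.+1)%:R) ('C(t, n)%:R) => e a b.
move: ('C(t + n, n.+1)%:R + _) ('C((t + n).+1, n)%:R) => y z h.
apply: subr0_eq; transitivity (e * ((a + b) * z - b * y)); first by ring.
by rewrite h subrr mulr0.
Qed.

Lemma alternating_bin_sum (R : comNzRingType) (n t : nat) :
  \sum_(k < n.+1) (-1) ^+ k * 'C(t.+1, k)%:R = (-1) ^+ n * 'C(t, n)%:R :> R.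
Proof.
elim: n => [|n IHn]; first by rewrite big_ord_recr big_ord0 /= !bin0; ring.
by rewrite big_ord_recr /= IHn binS natrD exprS; ring.
Qed.

(** * Binomial coefficients modulo p *)

Lemma dvdn_prime_pow_mul (p r a b c : nat) : prime p ->
  (a * b = p ^ r * c)%N -> ~~ (p ^ r %| a)%N -> (p %| b)%N.
Proof.
move=> pp eab; apply: contraR => pb.
have : (p ^ r %| a * b)%N by rewrite eab dvdn_mulr.
by rewrite Gauss_dvdl // coprimeXl // prime_coprime.
Qed.

(** From k C(u q, k) = u q C(u q - 1, k - 1), where q does not divide k. *)
Lemma dvdn_bin_mul_prime_pow (p r u k : nat) : prime p ->
  (0 < k < p ^ r)%N -> (p %| 'C(u * p ^ r, k))%N.
Proof.
case: k => // k pp /= kq.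
apply: (@dvdn_prime_pow_mul p r k.+1 _ (u * 'C((u * p ^ r).-1, k))) => //.
  by rewrite -mul_bin_diag; ring.
by rewrite gtnNdvd.
Qed.

(** In Vandermonde's expansion of C(u q + k, k), only the term C(k, k)
survives modulo p. *)
Lemma bin_add_mul_prime_pow (p r u k : nat) : prime p -> (k < p ^ r)%N ->
  exists c : nat, 'C(u * p ^ r + k, k) = (1 + p * c)%N.
Proof.
move=> pp kq; rewrite -binomial.Vandermonde big_ord_recl bin0 subn0 binn mul1n.
suff /dvdnP[c ->] : (p %| \sum_(i < k) 'C(u * p ^ r, lift ord0 i) *
    'C(k, k - lift ord0 i))%N by exists c; rewrite mulnC.
apply: dvdn_sum => i _; apply: dvdn_mulr; apply: dvdn_bin_mul_prime_pow => //.
by rewrite /= (leq_ltn_trans _ kq).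
Qed.

(** * The sums in a ring where p ^ 2 = 0 *)

Section SquareZero.

Variables (R : comNzRingType) (p r : nat).
Hypotheses (pp : prime p) (p_odd : odd p) (p2 : (p ^ 2)%:R = 0 :> R).
Let q := (p ^ r)%N.

Let q_gt0 : (0 < q)%N. Proof. by rewrite expn_gt0 prime_gt0. Qed.
Let qE : q = q.-1.+1. Proof. by rewrite prednK. Qed.
Let sign_q : (-1) ^+ q.-1 = 1 :> R.
Proof.
rewrite -signr_odd; suff -> : odd q.-1 = false by [].
by apply/negbTE; rewrite -oddS -qE oddX p_odd orbT.
Qed.

Lemma natrM_square0 (a b : nat) :
  (p %| a)%N -> (p %| b)%N -> (a * b)%:R = 0 :> R.
Proof.
move=> /dvdnP[c ->] /dvdnP[d ->].
by rewrite mulnACA mulnn natrM p2 mulr0.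
Qed.

(** The right-hand side of the telescoping relation is a product of two
multiples of p: multiplied by t + 1, each of its binomials becomes q times a
binomial, and q does not divide t + 1. *)
Lemma trunc_legendre_flip (t : nat) : ~~ (q %| t.+1)%N ->
  trunc_legendre R q t.+1 = - trunc_legendre R q t.
Proof.
move=> qt; apply/eqP; rewrite -addr_eq0 qE trunc_legendreS.
rewrite natrM_square0 ?mulr0 //.
  apply: (@dvdn_prime_pow_mul p r t.+1 _ 'C(t.+1, q)) => //.
  by rewrite (mul_bin_diag t.+1 q.-1) -qE.
apply: (@dvdn_prime_pow_mul p r t.+1 _ 'C(t.+1 + q.-1, q)) => //.
by have := mul_bin_left (t.+1 + q.-1) q.-1; rewrite -qE addnK => <-.
Qed.

Lemma trunc_legendre_flips (u j : nat) : (j < q)%N ->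
  trunc_legendre R q (u * q + j) = (-1) ^+ j * trunc_legendre R q (u * q).
Proof.
elim: j => [|j IHj] jq; first by rewrite addn0 mul1r.
rewrite addnS trunc_legendre_flip ?IHj ?exprS ?mulN1r ?mulNr ?(ltnW jq) //.
by rewrite -addnS dvdn_addr ?dvdn_mull // gtnNdvd.
Qed.

(** For 0 < k < q the factor C(u q + k, k) can be replaced by 1, since the
error is p C(u q, k) up to a factor, and p divides C(u q, k). *)
Lemma trunc_legendre_mul (u : nat) : (0 < u)%N ->
  trunc_legendre R q (u * q) = 'C((u * q).-1, q.-1)%:R.
Proof.
move=> u0; have uq : (0 < u * q)%N by rewrite muln_gt0 u0.
transitivity (\sum_(k < q) (-1) ^+ k * 'C(u * q, k)%:R : R).
  apply: eq_bigr => -[k /= kq] _; congr (_ * _).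
  have [-> | k0] := posnP k; first by rewrite !bin0.
  have [c ->] := bin_add_mul_prime_pow u pp kq.
  rewrite mulnDr muln1 natrD natrM_square0 ?addr0 ?dvdn_mulr //.
  by apply: dvdn_bin_mul_prime_pow; rewrite ?k0.
have := alternating_bin_sum R q.-1 (u * q).-1.
by rewrite -qE prednK // sign_q mul1r.
Qed.

(** As p ^ 2 is odd, it is 1 + 2 h, and a = p ^ 2 a - 2 h a. *)
Lemma mulr2_inj_square0 (a : R) : 2%:R * a = 0 -> a = 0.
Proof.
move=> a2; have : (p ^ 2)%:R * a = 0 by rewrite p2 mul0r.
rewrite -[(p ^ 2)%N]odd_double_half oddX p_odd orbT natrD -mul2n natrM.
by rewrite mulrDl mul1r mulrAC a2 mul0r addr0.
Qed.

(** Two-step induction on u: the telescoping relation at t + 1 = (u + 1) q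
expresses F((u + 2) q) through F((u + 1) q) and F(u q). *)
Lemma trunc_legendre_mul_eq1 (u : nat) : trunc_legendre R q (u * q) = 1.
Proof.
suff [] : trunc_legendre R q (u * q) = 1 /\ trunc_legendre R q (u.+1 * q) = 1.
  by [].
elim: u => [|u [IHu IHu1]]; split=> //.
- rewrite mul0n /trunc_legendre qE big_ord_recl !bin0 big1 ?addr0 ?mulr1 //.
  by move=> i _; rewrite bin0n mul0n mulr0.
- by rewrite trunc_legendre_mul // mul1n binn.
have uq : (u.+1 * q = (u * q + q.-1).+1)%N by rewrite mulSn addnC -addnS -qE.
have := trunc_legendreS R q.-1 (u * q + q.-1).
rewrite -uq -qE trunc_legendre_flips ?IHu ?IHu1; last first.
  by rewrite -subn1 ltn_subrL q_gt0.
have -> : (u.+1 * q + q.-1 = (u.+2 * q).-1)%N.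
  by rewrite [in RHS]mulSn addnC {3}qE.
rewrite natrM -trunc_legendre_mul //.
rewrite -[X in 'C(X, _)]/((u * q + q.-1).+1.-1) -uq.
rewrite -trunc_legendre_mul // IHu1 sign_q !mulr1 mul1r => h.
by apply: subr0_eq; apply: mulr2_inj_square0; rewrite mulrBr -h; ring.
Qed.

Lemma trunc_legendre_mod (t : nat) : trunc_legendre R q t = (-1) ^+ (t %% q).
Proof.
rewrite {1}(divn_eq t q) trunc_legendre_flips ?ltn_mod //.
by rewrite trunc_legendre_mul_eq1 mulr1.
Qed.

End SquareZero.

(** * Back to congruences between integers *)

Lemma intr_Zp_eq0 (m : nat) (z : int) : (1 < m)%N ->
  z%:~R = 0 :> 'Z_m -> (m%:Z %| z)%Z.
Proof.
move=> m1.
have nat0 (n : nat) : n%:R = 0 :> 'Z_m -> (m %| n)%N.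
  by move=> /(congr1 val); rewrite /= val_Zp_nat // => /eqP.
case: z => n; first exact: nat0.
by rewrite NegzE rmorphN => /eqP; rewrite oppr_eq0 => /eqP /nat0.
Qed.

Lemma trunc_legendre_int (p r t : nat) : prime p -> odd p ->
  ((p ^ 2)%:Z %| trunc_legendre int (p ^ r) t - (-1) ^+ (t %% p ^ r))%Z.
Proof.
move=> pp po; have p1 : (1 < p ^ 2)%N.
  by rewrite -(exp1n 2) ltn_exp2r ?prime_gt1.
apply: intr_Zp_eq0 => //; rewrite rmorphB rmorphXn rmorphN1 /=.
rewrite -(@trunc_legendre_mod _ _ _ pp po) // ?pchar_Zp //.
apply/eqP; rewrite subr_eq0; apply/eqP.
rewrite /trunc_legendre rmorph_sum; apply: eq_bigr => i _.
by rewrite rmorphM rmorphXn rmorphN1 /= rmorph_nat.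
Qed.

(** * Congruences in the localization of Z at p *)

Lemma Zloc_int (p : nat) (z : int) : prime p -> Zloc p z%:~R.
Proof. by move=> pp; rewrite /Zloc denq_int dvdn1 gtn_eqF ?prime_gt1. Qed.

Lemma Zloc_nat (p n : nat) : prime p -> Zloc p n%:R.
Proof. exact: (@Zloc_int p n). Qed.

Lemma ZlocD (p : nat) (a b : rat) :
  prime p -> Zloc p a -> Zloc p b -> Zloc p (a + b).
Proof.
move=> pp pa pb; rewrite -[a]divq_num_den -[b]divq_num_den.
rewrite addf_div ?intr_eq0 ?denq_neq0 // -!intrM -intrD.
by apply: Zloc_frac; rewrite abszM Euclid_dvdM // negb_or; apply/andP.
Qed.

Lemma ZlocM (p : nat) (a b : rat) :
  prime p -> Zloc p a -> Zloc p b -> Zloc p (a * b).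
Proof.
move=> pp pa pb; rewrite -[a]divq_num_den -[b]divq_num_den mulf_div -!intrM.
by apply: Zloc_frac; rewrite abszM Euclid_dvdM // negb_or; apply/andP.
Qed.

Lemma ZlocN (p : nat) (a : rat) : Zloc p a -> Zloc p (- a).
Proof. by rewrite /Zloc denqN. Qed.

Lemma eqmodp_refl (p m : nat) (a : rat) : prime p -> eqmodp p m a a.
Proof. by move=> pp; rewrite /eqmodp subrr mul0r (Zloc_int 0). Qed.

Lemma eqmodp_sym (p m : nat) (a b : rat) : eqmodp p m a b -> eqmodp p m b a.
Proof. by move=> /ZlocN; rewrite -mulNr opprB. Qed.

Lemma eqmodp_trans (p m : nat) (b a c : rat) : prime p ->
  eqmodp p m a b -> eqmodp p m b c -> eqmodp p m a c.
Proof.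
by move=> pp ab bc; have := ZlocD pp ab bc; rewrite -mulrDl subrKA.
Qed.

Lemma eqmodpD (p m : nat) (a b c d : rat) : prime p ->
  eqmodp p m a b -> eqmodp p m c d -> eqmodp p m (a + c) (b + d).
Proof.
move=> pp ab cd; have := ZlocD pp ab cd.
by rewrite -mulrDl addrACA -opprD.
Qed.

Lemma eqmodpN (p m : nat) (a b : rat) :
  eqmodp p m a b -> eqmodp p m (- a) (- b).
Proof. by move=> /eqmodp_sym; rewrite /eqmodp opprK addrC. Qed.

Lemma eqmodpM (p m : nat) (a b c d : rat) : prime p -> Zloc p b -> Zloc p c ->
  eqmodp p m a b -> eqmodp p m c d -> eqmodp p m (a * c) (b * d).
Proof.
move=> pp pb pc ab cd.
have := ZlocD pp (ZlocM pp ab pc) (ZlocM pp pb cd).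
by congr (Zloc p _); ring.
Qed.

Lemma eqmodp_le (p m n : nat) (a b : rat) : prime p -> (m <= n)%N ->
  eqmodp p n a b -> eqmodp p m a b.
Proof.
move=> pp mn ab; have := ZlocM pp ab (Zloc_nat (p ^ (n - m)) pp).
congr (Zloc p _); rewrite -mulrA; congr (_ * _).
have p0 : p%:R != 0 :> rat by rewrite pnatr_eq0 -lt0n prime_gt0.
by rewrite -{1}(subnK mn) exprD natrX invfM mulrAC mulVf ?mul1r // expf_neq0.
Qed.

(** The precision lost by a division by n is the p-adic valuation of n. *)
Lemma eqmodp_divn (p m n : nat) (a b : rat) : prime p -> (0 < n)%N ->
  eqmodp p (m + logn p n) a b -> eqmodp p m (a / n%:R) (b / n%:R).
Proof.
move=> pp n0; have [c pc nE] := pfactor_coprime pp n0; rewrite {2 3}nE => ab.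
have pc' : Zloc p (1%:~R / c%:Z%:~R).
  by apply: Zloc_frac; rewrite -prime_coprime.
have := ZlocM pp ab pc'; congr (Zloc p _).
by rewrite natrM natrX exprD -mulrBl !invfM div1r; ring.
Qed.

Lemma eqmodp_int (p m : nat) (a b : int) : prime p ->
  eqmodp p m a%:~R b%:~R = ((p ^ m)%:Z %| a - b)%Z.
Proof.
move=> pp; have q0 : (p ^ m)%:Z%:~R != 0 :> rat.
  by rewrite intr_eq0 eqz_nat -lt0n expn_gt0 prime_gt0.
rewrite /eqmodp -intrB -natrX; move: (a - b) => z.
apply/idP/idP => [pz | /dvdzP[k ->]]; last first.
  by rewrite intrM mulfK // Zloc_int.
have := divq_num_den (z%:~R / (p ^ m)%:R); move: pz; rewrite /Zloc.
move: (numq _) (denq_neq0 (z%:~R / (p ^ m)%:R)) => n.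
move: (denq _) => d d0 pd /eqP.
rewrite eqr_div ?intr_eq0 // -[(p ^ m)%:R]/((p ^ m)%:Z%:~R).
rewrite -!intrM eqr_int => /eqP e.
have : ((p ^ m)%:Z %| z * d)%Z by rewrite -e dvdz_mull.
by rewrite Gauss_dvdzl // coprimezE coprimeXl // prime_coprime.
Qed.

Lemma eqmodp_nat (p m a b : nat) : prime p ->
  eqmodp p m a%:R b%:R -> a = b %[mod p ^ m].
Proof.
move=> pp; rewrite (eqmodp_int m a b) // -eqz_mod_dvd => /eqP.
by rewrite !modz_nat => -[].
Qed.

(** The inverse u of the denominator modulo p ^ m comes from Bezout; the
residue of u * numq a is taken only to get a natural number. *)
Lemma eqmodp_nat_ex (p m : nat) (a : rat) : prime p -> Zloc p a ->
  exists t : nat, eqmodp p m a t%:R.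
Proof.
move=> pp pa; have cop : coprimez (denq a) (p ^ m)%:Z.
  by rewrite coprimezE /= coprime_sym coprimeXl // prime_coprime.
have /coprimezP [[u v] /= uv] := cop.
have q0 : (p ^ m)%:Z != 0 by rewrite eqz_nat -lt0n expn_gt0 prime_gt0.
pose s := ((u * numq a) %% (p ^ m)%:Z)%Z; exists `|s|%N.
apply: (@eqmodp_trans _ _ (u * numq a)%:~R) => //; last first.
  rewrite (eqmodp_int m _ `|s|%N) // gez0_abs ?modz_ge0 //.
  by rewrite -eqz_mod_dvd modz_mod.
rewrite /eqmodp; suff -> : a - (u * numq a)%:~R = a * v%:~R * (p ^ m)%:R.
  rewrite -natrX mulfK; first by rewrite ZlocM ?Zloc_int.
  by rewrite pnatr_eq0 -lt0n expn_gt0 prime_gt0.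
have /(congr1 (fun z : int => z%:~R : rat)) := uv.
rewrite intrD !intrM numqE -[(p ^ m)%:R]/((p ^ m)%:Z%:~R) => e.
transitivity (a * (1 - u%:~R * (denq a)%:~R)); first by ring.
by rewrite -[X in X - _]/(1%:~R) -e; ring.
Qed.

Lemma least_residue_unique (p s : nat) (a : rat) : prime p -> Zloc p a ->
  (s < p)%N -> eqmodp p 1 a s%:R -> least_residue p a = s.
Proof.
move=> pp pa sp /eqmodp_sym es; have [lp el _] := least_residueP pp pa.
have := eqmodp_nat pp (eqmodp_trans pp es el).
by rewrite expn1 !modn_small.
Qed.

Lemma Zloc_pochhammer (p k : nat) (a : rat) : prime p -> Zloc p a ->
  Zloc p (pochhammer a k).
Proof.
move=> pp pa; rewrite /pochhammer; elim: k => [|k IHk].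
  by rewrite big_ord0 (Zloc_nat 1).
by rewrite big_ord_recr ZlocM // ZlocD // Zloc_nat.
Qed.

Lemma eqmodp_pochhammer (p m k : nat) (a b : rat) : prime p ->
  Zloc p a -> Zloc p b -> eqmodp p m a b ->
  eqmodp p m (pochhammer a k) (pochhammer b k).
Proof.
move=> pp pa pb ab; elim: k => [|k IHk].
  by rewrite /pochhammer !big_ord0 eqmodp_refl.
rewrite /pochhammer !big_ord_recr eqmodpM //; first exact: Zloc_pochhammer.
  by rewrite ZlocD // Zloc_nat.
by rewrite eqmodpD // eqmodp_refl.
Qed.

(** * The hypergeometric sum of a p-integral argument *)

Lemma pochhammer1 (k : nat) : pochhammer (1 : rat) k = k`!%:R.
Proof.
rewrite /pochhammer; elim: k => [|k IHk]; first by rewrite big_ord0.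
by rewrite big_ord_recr IHk factS mulnC natrM -nat1r.
Qed.

Lemma pochhammerN_nat (t k : nat) :
  pochhammer (- t%:R : rat) k = (-1) ^+ k * (t ^_ k)%:R.
Proof.
rewrite /pochhammer; elim: k => [|k IHk]; first by rewrite big_ord0 mulr1.
rewrite big_ord_recr IHk /= ffactnSr exprS natrM.
have [kt | tk] := leqP k t; first by rewrite natrB //; ring.
by rewrite ffact_small // !(mul0r, mulr0).
Qed.

Lemma pochhammer_nat (t k : nat) :
  pochhammer (1 + t%:R : rat) k = ((t + k) ^_ k)%:R.
Proof.
rewrite /pochhammer; elim: k => [|k IHk]; first by rewrite big_ord0.
rewrite big_ord_recr IHk /= addnS ffactSS natrM -natr1 natrD; ring.
Qed.

Definition hypergeometric_sum (x : rat) (n : nat) : rat :=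
  \sum_(0 <= k < n)
    pochhammer x k * pochhammer (1 - x) k / pochhammer 1 k ^+ 2.

Lemma hypergeometric_sumN_nat (t n : nat) :
  hypergeometric_sum (- t%:R) n = (trunc_legendre int n t)%:~R.
Proof.
rewrite /hypergeometric_sum big_mkord /trunc_legendre rmorph_sum /=.
apply: eq_bigr => k _; rewrite opprK pochhammerN_nat pochhammer_nat pochhammer1.
rewrite -!bin_ffact [RHS]rmorphM rmorphXn rmorphN1 /= rmorph_nat !natrM; field.
by rewrite pnatr_eq0 -lt0n fact_gt0.
Qed.

(** p-adic continuity: all denominators k! ^ 2 with k < n divide n! ^ 2, whose
valuation is thus the only loss of precision. *)
Lemma eqmodp_hypergeometric_sum (p m n : nat) (x y : rat) : prime p ->
  Zloc p x -> Zloc p y -> eqmodp p (m + logn p (n`! ^ 2)) x y ->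
  eqmodp p m (hypergeometric_sum x n) (hypergeometric_sum y n).
Proof.
move=> pp px py xy; rewrite /hypergeometric_sum !big_mkord.
elim/big_ind2: _ => [|a b c d ab cd|k _]; first exact: eqmodp_refl.
  exact: eqmodpD.
have pz1 z : Zloc p z -> Zloc p (1 - z).
  by move=> pz; rewrite ZlocD ?ZlocN // (Zloc_nat 1).
rewrite pochhammer1 -natrX; apply: eqmodp_divn; rewrite ?expn_gt0 ?fact_gt0 //.
apply: (@eqmodp_le _ _ (m + logn p (n`! ^ 2))) => //.
  rewrite leq_add2l dvdn_leq_log ?expn_gt0 ?fact_gt0 // dvdn_exp2r //.
  by rewrite -(bin_fact (ltnW (ltn_ord k))) mulnCA dvdn_mulr.
rewrite eqmodpM ?Zloc_pochhammer ?eqmodp_pochhammer ?pz1 //.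
by rewrite eqmodpD ?eqmodpN ?eqmodp_refl.
Qed.

(** The value of the sum is a sign for every p-integral x; the special values
of the final result only serve to compute that sign. *)
Theorem hypergeometric_sum_residue (p r t : nat) (x : rat) :
  prime p -> odd p -> Zloc p x -> (t < p ^ r)%N -> eqmodp p r (- x) t%:R ->
  eqmodp p 2 (hypergeometric_sum x (p ^ r)) ((-1) ^+ t).
Proof.
move=> pp po px tq xt; set e := logn p ((p ^ r)`! ^ 2).
(* Precision 2 + e makes the sums congruent modulo p ^ 2, and precision r lets
   s and t agree modulo p ^ r. *)
have [s xs] := eqmodp_nat_ex (r + (2 + e)) pp (ZlocN px).
have st : (s %% p ^ r = t)%N.
  have xsr := eqmodp_le pp (leq_addr _ _) xs.
  have := eqmodp_nat pp (eqmodp_trans pp (eqmodp_sym xsr) xt).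
  by rewrite (modn_small tq).
apply: (@eqmodp_trans _ _ (hypergeometric_sum (- s%:R) (p ^ r))) => //.
  apply: eqmodp_hypergeometric_sum; rewrite ?ZlocN ?Zloc_nat //.
  by rewrite -[x]opprK eqmodpN // (eqmodp_le pp (leq_addl _ _) xs).
rewrite hypergeometric_sumN_nat -st.
have -> : (-1) ^+ (s %% p ^ r) = ((-1) ^+ (s %% p ^ r) : int)%:~R :> rat.
  by rewrite rmorphXn rmorphN1.
by rewrite eqmodp_int // trunc_legendre_int.
Qed.

(** * The parity of the residue of - 1 / d modulo p ^ r *)

(** The residue is m (1 + p + ... + p ^ (r - 1)), and p is odd. *)
Lemma neg_inv_residue_parity1 (p d m r : nat) : odd p -> p = (d * m).+1 ->
  exists2 a : nat, (d * a).+1 = (p ^ r)%N & odd a = odd (m * r).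
Proof.
move=> po pE; elim: r => [|r [a aE a_odd]]; first by exists 0%N; rewrite !muln0.
exists (a * p + m)%N.
  by rewrite expnS -aE {2}pE {1}pE; ring.
by rewrite oddD oddM a_odd po andbT mulnS oddD addbC.
Qed.

(** Here d.+2 is the denominator, and s the residue modulo p.  The numerator
c in a = (c p ^ r - 1) / d.+2 alternates between 1 and d.+1.  With q = p ^ r,
the next residue is p q - (p a + m) after c = 1, and p (q - a) - m after
c = d.+1; both have the parity of a + s, since p and q are odd. *)
Lemma neg_inv_residue_parityN1 (p d s m r : nat) :
  odd p -> p.+1 = (d.+2 * m)%N -> (s + m = p)%N ->
  exists a : nat,
    [/\ ((d.+2 * a).+1 = p ^ r)%N \/ ((d.+2 * a).+1 = d.+1 * p ^ r)%N,
        (a < p ^ r)%N & odd a = odd (s * r)].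
Proof.
move=> po pE sE; elim: r => [|r [a [aE a_lt a_odd]]].
  by exists 0%N; split; [left | | rewrite !muln0]; rewrite ?muln0.
have qo : odd (p ^ r) by rewrite oddX po orbT.
have so : odd s = ~~ odd m.
  by move: po; rewrite -sE oddD; case: (odd s); case: (odd m).
rewrite expnS mulnS oddD -a_odd; move: (p ^ r)%N aE a_lt qo => q aE a_lt qo.
have q0 : (0 < p * q)%N by rewrite muln_gt0 !odd_gt0.
case: aE => aE.
- have e : (d.+2 * (p * a + m) = (p * q).+1)%N by rewrite -aE mulnDr -pE; ring.
  have le : (p * a + m <= p * q)%N.
    by rewrite -(@leq_pmul2l d.+2) // e !mulSn; lia.
  exists (p * q - (p * a + m))%N; split.
  + by right; rewrite mulnBr e; move: le; lia.
  + by move: e le; case: (p * a + m)%N => [|b] e le; [rewrite muln0 in e | lia].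
  + by rewrite oddB // oddD !oddM po qo so /=; case: (odd a); case: (odd m).
- have e : (d.+2 * (q - a) = q.+1)%N by rewrite mulnBr; lia.
  have e2 : (d.+2 * (p * (q - a)) = p * q + p)%N by rewrite mulnCA e; ring.
  have le : (m <= p * (q - a))%N.
    by rewrite -(@leq_pmul2l d.+2) // e2 -pE; lia.
  have e3 : (d.+2 * (p * (q - a) - m)).+1 = (p * q)%N.
    by rewrite mulnBr e2 -pE; lia.
  exists (p * (q - a) - m)%N; split; first by left.
  + by move: e3; move: (p * (q - a) - m)%N (p * q)%N => b c; lia.
  + by rewrite oddB // oddM oddB ?(ltnW a_lt) // po qo so /=;
      case: (odd a); case: (odd m).
Qed.

Lemma eqmodp_neg_inv (p d r a c : nat) : prime p -> ~~ (p %| d)%N ->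
  (d * a).+1 = (c * p ^ r)%N -> eqmodp p r (- (1 / d%:R)) a%:R.
Proof.
move=> pp pd e; rewrite /eqmodp.
have d0 : d%:R != 0 :> rat by rewrite pnatr_eq0; apply: contraNneq pd => ->.
have p0 : p%:R ^+ r != 0 :> rat.
  by rewrite expf_neq0 // pnatr_eq0 -lt0n prime_gt0.
suff -> : (- (1 / d%:R) - a%:R) / p%:R ^+ r = (- c%:Z)%:~R / d%:Z%:~R :> rat.
  exact: Zloc_frac.
have {}e : d%:R * a%:R + 1 = c%:R * p%:R ^+ r :> rat.
  by rewrite -natrX -!natrM -e natr1.
rewrite mulrNz -[c%:~R]/(c%:R) -[d%:~R]/(d%:R).
apply/eqP; rewrite eqr_div //; apply/eqP; rewrite mulNr -e; field.
by [].
Qed.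

Theorem corollary1p4 (p r : nat) (x : rat) (pp : prime p)
    (hp : (5 <= p)%N) (hr : (0 < r)%N)
    (hx : x \in [:: 1 / 2%:R; 1 / 3%:R; 1 / 4%:R; 1 / 6%:R]) :
  eqmodp p 2
    (\sum_(0 <= k < p ^ r)
       pochhammer x k * pochhammer (1 - x) k / pochhammer 1 k ^+ 2)
    ((-1) ^+ (least_residue p (- x) * r)).
Proof.
have p2 : ~~ (2 %| p)%N.
  by rewrite dvdn_prime2 // neq_ltn (leq_trans _ hp) ?orbT.
have p3 : ~~ (3 %| p)%N.
  by rewrite dvdn_prime2 // neq_ltn (leq_trans _ hp) ?orbT.
have po : odd p by move: p2; rewrite dvdn2 negbK.
(* The denominator is shifted by 2 so that d.+2 and d.+1 need no subtraction. *)
have [d [xE pd pmod]] : exists d : nat, [/\ x = 1 / d.+2%:R, ~~ (p %| d.+2)%N &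
    (exists m, p = (d.+2 * m).+1) \/ (exists m, p.+1 = (d.+2 * m)%N)].
  have pdvd (d : nat) : d \in [:: 2; 3; 4; 6]%N -> ~~ (p %| d)%N.
    rewrite !inE => /or4P[] /eqP ->; apply/negP => pd.
    - by move/dvdn_leq: pd => /(_ isT); lia.
    - by move/dvdn_leq: pd => /(_ isT); lia.
    - by move/dvdn_leq: pd => /(_ isT); lia.
    - move: pd; rewrite (@Euclid_dvdM 2 3 p) // => /orP[] /dvdn_leq => /(_ isT);
        by lia.
  move: hx; rewrite !inE => /or4P[] /eqP ->.
  - by exists 0%N; split=> //; [exact: pdvd | left; exists (p %/ 2)%N; lia].
  - exists 1%N; split=> //; first exact: pdvd.
    have [?|?] : (p %% 3 = 1 \/ p %% 3 = 2)%N by lia.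
      by left; exists (p %/ 3)%N; lia.
    by right; exists (p.+1 %/ 3)%N; lia.
  - exists 2%N; split=> //; first exact: pdvd.
    have [?|?] : (p %% 4 = 1 \/ p %% 4 = 3)%N by lia.
      by left; exists (p %/ 4)%N; lia.
    by right; exists (p.+1 %/ 4)%N; lia.
  - exists 4%N; split=> //; first exact: pdvd.
    have [?|?] : (p %% 6 = 1 \/ p %% 6 = 5)%N by lia.
      by left; exists (p %/ 6)%N; lia.
    by right; exists (p.+1 %/ 6)%N; lia.
have px : Zloc p x by rewrite xE; apply: (@Zloc_frac p 1 d.+2).
suff [s [a [sp s_res aq a_res as_odd]]] : exists s a : nat,
    [/\ (s < p)%N, eqmodp p 1 (- x) s%:R, (a < p ^ r)%N,
        eqmodp p r (- x) a%:R & odd a = odd (s * r)].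
  rewrite (least_residue_unique pp (ZlocN px) sp s_res).
  rewrite -signr_odd -as_odd signr_odd.
  exact: hypergeometric_sum_residue.
case: pmod => [[m pE] | [m pE]].
  have [a aE a_odd] := neg_inv_residue_parity1 r po pE.
  exists m, a; rewrite xE; split=> //.
  - by rewrite pE; lia.
  - by apply: (@eqmodp_neg_inv _ _ _ _ 1); rewrite // mul1n expn1.
  - by rewrite -aE ltnS; lia.
  - by apply: (@eqmodp_neg_inv _ _ _ _ 1); rewrite // mul1n.
have mp : (m <= p)%N by lia.
have m0 : (0 < m)%N.
  by rewrite lt0n; apply: contra_eqN pE => /eqP ->; rewrite muln0.
have sE := subnK mp.
have [a [aE a_lt a_odd]] := neg_inv_residue_parityN1 r po pE sE.
exists (p - m)%N, a; rewrite xE; split=> //.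
- by lia.
- by apply: (@eqmodp_neg_inv _ _ _ _ d.+1); rewrite // mulnBr -pE expn1; lia.
case: aE => aE; last by apply: (@eqmodp_neg_inv _ _ _ _ d.+1).
by apply: (@eqmodp_neg_inv _ _ _ _ 1); rewrite // mul1n.
Qed.
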